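(* Let $d\ge 3$ and $n\ge 2$. Every convex system $\{K_1,\ldots,K_n\}$ in $\mathbb{R}^d$ has an ordinary line.
   Context: A convex system in $\mathbb{R}^d$ ($d\ge 2$) is a family $\mathcal F=\{K_1,\ldots,K_n\}$, $n\ge 2$, of pairwise disjoint, compact, strictly convex sets in $\mathbb{R}^d$, each with nonempty interior. Let $U=\bigcup_{i=1}^n K_i$. A line $L$ is called an ordinary line of $\mathcal F$ if $L\cap U$ consists of exactly two points. *)

(* Defs.v *)
From HB Require Import structures.
From mathcomp Require Import all_boot all_order all_algebra.
From mathcomp Require Import all_classical all_reals all_analysis.

Set Implicit Arguments.
Unset Strict Implicit.
Unset Printing Implicit Defensive.

Import Order.TTheory GRing.Theory Num.Theory.
Import numFieldNormedType.Exports.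

Local Open Scope classical_set_scope.
Local Open Scope ring_scope.

(* The topology on row vectors is the one induced by the max norm, which is
   the usual Euclidean topology. *)
Definition strictly_convex (R : realType) (d : nat) (A : set 'rV[R]_d) : Prop :=
  forall (x y : 'rV[R]_d) (t : R), A x -> A y -> x != y -> 0 < t < 1 ->
    interior A ((1 - t) *: x + t *: y).

Definition convex_system (R : realType) (d n : nat)
    (K : 'I_n -> set 'rV[R]_d) : Prop :=
  [/\ (2 <= d)%N,
      (2 <= n)%N,
      trivIset [set: 'I_n] K &
      forall i, [/\ compact (K i), strictly_convex (K i) & interior (K i) !=set0]].

Definition line (R : realType) (d : nat) (L : set 'rV[R]_d) : Prop :=
  exists p v : 'rV[R]_d, v != 0 /\ L = [set p + t *: v | t in [set: R]].

Definition ordinary_line (R : realType) (d n : nat)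
    (K : 'I_n -> set 'rV[R]_d) (L : set 'rV[R]_d) : Prop :=
  line L /\
  exists x y : 'rV[R]_d, x != y /\ L `&` (\bigcup_(i in [set: 'I_n]) K i) = [set x; y].

(* Main.v *)
(* Rotating a direction w from one where K_i is extreme to one where it is not
   gives a hyperplane H supporting the union at two bodies at least, at points
   p and q say.  Choose points of these two bodies on a common level slightly
   below H, so that with p and q they span a 3-dimensional flat, and cut all
   bodies by that flat, with coordinates (x, y, z), z being the depth below H,
   p = (0, 0, 0) and q = (1, 0, 0).
   For small generic eps > 0, take the least depth at which a line of direction
   (1, eps, 0) meets two bodies.  Since q - p is nearly parallel to the line,
   this depth is small, and by genericity it is positive.  That line is
   ordinary.  It meets each body once: by strict convexity a second point would
   put an interior point on the line and allow an earlier meeting.  At that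
   depth every body met by the line has points off the line, to its left or to
   its right in the lateral coordinate y - eps x, and two bodies with such points
   on the same side would have met earlier; so the line meets at most two. *)

Require Import Defs.
From mathcomp Require Import all_boot all_order all_algebra.
From mathcomp Require Import all_classical all_reals all_analysis.
From mathcomp Require Import ring lra zify.

Set Implicit Arguments.
Unset Strict Implicit.
Unset Printing Implicit Defensive.

Import Order.TTheory GRing.Theory Num.Theory.
Import numFieldNormedType.Exports.

Local Open Scope classical_set_scope.
Local Open Scope ring_scope.

(** * Continuity, interior points and segments *)

Lemma mulmxr_continuous (R : realType) (m n : nat) (B : 'M[R]_(m, n)) :
  continuous (fun x : 'rV[R]_m => x *m B).
Proof.
rewrite (_ : (fun x => _) = fun x : 'rV[R]_m => \sum_i x 0 i *: row i B); last first.
  by apply/funext => x; rewrite mulmx_sum_row.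
apply: continuous_big => [|i _ x]; first exact: add_continuous.
by apply: (@cvgZr_tmp _ _ _ (nbhs x)); exact: coord_continuous.
Qed.

Lemma interior_ray (R : realType) (d : nat) (A : set 'rV[R]_d) x v :
  interior A x ->
  exists2 s0 : R, 0 < s0 & forall s, 0 <= s <= s0 -> A (x + s *: v).
Proof.
move=> Ax.
have cts : {for 0, continuous (fun s : R => x + s *: v)}.
  apply: (@cvgD _ _ _ _ _ (cst x) (fun s => s *: v)); first exact: cvg_cst.
  apply: cvgZr_tmp; exact: cvg_id.
have : nbhs (0 : R) ((fun s : R => x + s *: v) @^-1` A).
  by apply: cts; rewrite scale0r addr0.
move=> /nbhs_ballP[e /= e0 He]; exists (e / 2); first by lra.
move=> s /andP[s0 se]; apply: He; rewrite /ball /= sub0r normrN ger0_norm//; lra.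
Qed.

Lemma strictly_convex_segment (R : realType) (d : nat) (A : set 'rV[R]_d) x y t :
  strictly_convex A -> A x -> A y -> 0 <= t <= 1 -> A ((1 - t) *: x + t *: y).
Proof.
move=> cA Ax Ay /andP[t0 t1].
have [<-|xy] := eqVneq x y; first by rewrite -scalerDl subrK scale1r.
have [->|tn0] := eqVneq t 0; first by rewrite subr0 scale1r scale0r addr0.
have [->|tn1] := eqVneq t 1; first by rewrite subrr scale1r scale0r add0r.
by apply: interior_subset; apply: cA => //; lra.
Qed.

(** * Spatial coordinates and first meetings along a direction *)

Definition abscissa (R : realType) (v : 'rV[R]_3) : R := v 0 ord0.
Definition depth (R : realType) (v : 'rV[R]_3) : R := v 0 (@Ordinal 3 2 isT).
Definition ordinate (R : realType) (v : 'rV[R]_3) : R := v 0 (@Ordinal 3 1 isT).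
Definition lat (R : realType) (eps : R) (v : 'rV[R]_3) : R :=
  ordinate v - eps * abscissa v.
Definition point3 (R : realType) (x y z : R) : 'rV[R]_3 :=
  \row_i [:: x; y; z]`_i.

Lemma row3P (R : realType) (v w : 'rV[R]_3) :
  abscissa v = abscissa w -> ordinate v = ordinate w -> depth v = depth w ->
  v = w.
Proof.
move=> h0 h1 h2; apply/rowP => -[[|[|[|//]]] hi].
- by rewrite (_ : Ordinal hi = ord0) //; apply: val_inj.
- by rewrite (_ : Ordinal hi = @Ordinal 3 1 isT) //; apply: val_inj.
- by rewrite (_ : Ordinal hi = @Ordinal 3 2 isT) //; apply: val_inj.
Qed.

Lemma depth_continuous (R : realType) : continuous (@depth R).
Proof. exact: coord_continuous. Qed.

Lemma lat_continuous (R : realType) (eps : R) : continuous (lat eps).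
Proof.
move=> v; apply: (@cvgB _ _ _ (nbhs v)); first exact: coord_continuous.
by apply: (@cvgM _ _ (nbhs v)); [exact: cvg_cst|exact: coord_continuous].
Qed.

(* Two points with equal [depth] and equal [lat eps] lie on a common line of
   direction (1, eps, 0). *)
Definition meeting (R : realType) (n : nat) (A : 'I_n -> set 'rV[R]_3)
    (eps : R) (a b : 'I_n) (X Y : 'rV[R]_3) : Prop :=
  [/\ a != b, A a X, A b Y, depth X = depth Y & lat eps X = lat eps Y].

Lemma closed_eq_fun (R : realType) (T : topologicalType) (f g : T -> R) :
  continuous f -> continuous g -> closed [set x | f x = g x].
Proof.
move=> cf cg.
rewrite (_ : [set x | f x = g x] = (fun x => f x - g x) @^-1` [set 0]).
  apply: preimage_closed; last exact: closed_eq.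
  by move=> x _; apply: (@cvgB _ _ _ (nbhs x)); [exact: cf|exact: cg].
apply/seteqP; split => x /= => [->|/eqP]; first exact: subrr.
by rewrite subr_eq0 => /eqP.
Qed.

(** Pairs of points of two different bodies on a common line of the given direction form a finite
    union of compact sets, on which [depth] attains its minimum. *)
Lemma first_meeting (R : realType) (n : nat) (A : 'I_n -> set 'rV[R]_3)
    (eps : R) (a0 b0 : 'I_n) (X0 Y0 : 'rV[R]_3) :
  (forall i, compact (A i)) -> meeting A eps a0 b0 X0 Y0 ->
  exists a b X Y, meeting A eps a b X Y /\
    forall c d Z W, meeting A eps c d Z W -> depth X <= depth Z.
Proof.
move=> cA m0.
pose S (ij : 'I_n * 'I_n) : set ('rV[R]_3 * 'rV[R]_3) :=
  (A ij.1 `*` A ij.2) `&`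
  ([set p | depth p.1 = depth p.2] `&` [set p | lat eps p.1 = lat eps p.2]).
pose C := \bigcup_(ij in [set` [pred ij : 'I_n * 'I_n | ij.1 != ij.2]]) S ij.
have fst_cts (f : 'rV[R]_3 -> R) : continuous f ->
    continuous (fun p : 'rV[R]_3 * 'rV[R]_3 => f p.1).
  move=> cf p; apply: (@continuous_comp _ _ _ fst f); [exact: cvg_fst|exact: cf].
have snd_cts (f : 'rV[R]_3 -> R) : continuous f ->
    continuous (fun p : 'rV[R]_3 * 'rV[R]_3 => f p.2).
  move=> cf p; apply: (@continuous_comp _ _ _ snd f); [exact: cvg_snd|exact: cf].
have cC : compact C.
  rewrite /C bigcup_pred; apply: bigsetU_compact => ij _.
  apply: compact_closedI; first exact: compact_setX.
  apply: closedI; apply: closed_eq_fun.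
  - exact/fst_cts/depth_continuous.
  - exact/snd_cts/depth_continuous.
  - exact/fst_cts/lat_continuous.
  - exact/snd_cts/lat_continuous.
have inC c d Z W : meeting A eps c d Z W -> C (Z, W).
  by case=> cd Z_ W_ zz ll; exists (c, d).
have [||[X Y] XY minXY] := @compact_EVT_min _ R (fun p => depth p.1) C _ cC.
- by exists (X0, Y0); exact: inC m0.
- by apply: continuous_subspaceT; exact/fst_cts/depth_continuous.
move: XY; rewrite inE => -[[a b] /= ab [[/= Xa Yb] [/= hz hl]]].
exists a, b, X, Y; split; first by split.
move=> c d Z W m; apply: (minXY (Z, W)); rewrite inE; exact: inC m.
Qed.

Lemma depth_ray (R : realType) (x v : 'rV[R]_3) s :
  depth (x + s *: v) = depth x + s * depth v.
Proof. by rewrite /depth !mxE. Qed.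

Lemma depth_segment (R : realType) (x y : 'rV[R]_3) t :
  depth ((1 - t) *: x + t *: y) = (1 - t) * depth x + t * depth y.
Proof. by rewrite /depth !mxE. Qed.

Lemma lat_ray (R : realType) (eps : R) (x v : 'rV[R]_3) s :
  lat eps (x + s *: v) = lat eps x + s * lat eps v.
Proof. by rewrite /lat /ordinate /abscissa !mxE; ring. Qed.

Lemma lat_segment (R : realType) (eps : R) (x y : 'rV[R]_3) t :
  lat eps ((1 - t) *: x + t *: y) = (1 - t) * lat eps x + t * lat eps y.
Proof. by rewrite /lat /ordinate /abscissa !mxE; ring. Qed.

Lemma depthB (R : realType) (x y : 'rV[R]_3) : depth (x - y) = depth x - depth y.
Proof. by rewrite /depth !mxE. Qed.

Lemma latB (R : realType) (eps : R) (x y : 'rV[R]_3) :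
  lat eps (x - y) = lat eps x - lat eps y.
Proof. by rewrite /lat /ordinate /abscissa !mxE; ring. Qed.

Lemma depth_point3 (R : realType) (x y z : R) : depth (point3 x y z) = z.
Proof. by rewrite /depth mxE. Qed.

Lemma lat_point3 (R : realType) (eps x y z : R) :
  lat eps (point3 x y z) = y - eps * x.
Proof. by rewrite /lat /ordinate /abscissa !mxE. Qed.

Definition no_meeting_above (R : realType) (n : nat) (A : 'I_n -> set 'rV[R]_3)
    (eps z0 : R) : Prop :=
  forall a b X Y, meeting A eps a b X Y -> z0 <= depth X.

(* If the line met [A a] twice, the midpoint would be interior, and sliding
   both bodies' points along [T - Y] would give an earlier meeting. *)
Lemma first_meeting_unique (R : realType) (n : nat) (A : 'I_n -> set 'rV[R]_3)
    (eps z0 : R) a b X Y T X' :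
  (forall i, strictly_convex (A i)) -> no_meeting_above A eps z0 -> 0 < z0 ->
  meeting A eps a b X Y -> depth X = z0 -> A b T -> depth T = 0 ->
  A a X' -> depth X' = z0 -> lat eps X' = lat eps X -> X' = X.
Proof.
move=> sA minz z0_gt0 [ab aX bY zXY lXY] zX bT zT aX' zX' lX'.
apply/eqP/negP => /negP neq.
have half : 0 < (1 / 2 : R) < 1 by lra.
have Mint := sA a X' X _ aX' aX neq half.
have [s0 s0_gt0 Hs0] := interior_ray (T - Y) Mint.
pose s := Num.min s0 1.
have s_gt0 : 0 < s by rewrite lt_min s0_gt0 ltr01.
have s_le1 : s <= 1 by rewrite ge_min lexx orbT.
have s_les0 : s <= s0 by rewrite ge_min lexx.
have bW : A b ((1 - s) *: Y + s *: T).
  by apply: strictly_convex_segment => //; lra.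
have aM := Hs0 s ltac:(lra).
have : z0 <= (1 - s) * z0.
  have -> : (1 - s) * z0 =
      depth ((1 - 1 / 2) *: X' + 1 / 2 *: X + s *: (T - Y)).
    by rewrite depth_ray depth_segment depthB zX zX' zT -zXY zX; field.
  apply: minz; split; [exact: ab|exact: aM|exact: bW| |].
    by rewrite depth_ray !depth_segment depthB zX zX' zT -zXY zX; field.
  by rewrite lat_ray !lat_segment latB lX' lXY; field.
by nra.
Qed.

(** If two points descend linearly from the tops to depth [z0] and swap their lateral order, they
    have equal [lat] at some moment, which is a meeting above [z0]. *)
Lemma no_crossing (R : realType) (n : nat) (A : 'I_n -> set 'rV[R]_3)
    (eps z0 : R) a b Ta Na Tb Nb :
  (forall i, strictly_convex (A i)) -> no_meeting_above A eps z0 -> 0 < z0 ->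
  a != b -> A a Ta -> A a Na -> A b Tb -> A b Nb ->
  depth Ta = 0 -> depth Tb = 0 -> depth Na = z0 -> depth Nb = z0 ->
  lat eps Ta < lat eps Tb -> lat eps Na <= lat eps Nb.
Proof.
move=> sA minz z0_gt0 ab aT aN bT bN zTa zTb zNa zNb lT.
rewrite leNgt; apply/negP => lN.
set D := lat eps Tb - lat eps Ta; set D' := lat eps Na - lat eps Nb.
have D_gt0 : 0 < D by rewrite subr_gt0.
have D'_gt0 : 0 < D' by rewrite subr_gt0.
(* The lateral gap at parameter [s] is [(1 - s) * D - s * D']; this [s] is its zero. *)
pose s := D / (D + D').
have sE : s * (D + D') = D by rewrite /s divfK//; lra.
have s_gt0 : 0 < s by rewrite divr_gt0//; lra.
have s_lt1 : s < 1 by nra.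
have : z0 <= depth ((1 - s) *: Ta + s *: Na).
  apply: (minz a b _ ((1 - s) *: Tb + s *: Nb)); split => //.
  - by apply: strictly_convex_segment => //; lra.
  - by apply: strictly_convex_segment => //; lra.
  - by rewrite !depth_segment zTa zTb zNa zNb.
  - rewrite !lat_segment; move: sE; rewrite /D /D' => sE; lra.
rewrite depth_segment zTa zNa; nra.
Qed.

Lemma direction_neq0 (R : realType) (eps : R) : point3 1 eps 0 != 0.
Proof.
apply/eqP => /(congr1 (@abscissa R)); rewrite /abscissa !mxE/= => /eqP.
by rewrite oner_eq0.
Qed.

(** The segment from [Ta] to [Ba] crosses depth [z0] at an interior point of [A a]. If that point
    were on the line, the body would contain further points of the line, against
    [first_meeting_unique]. *)
Lemma off_line (R : realType) (n : nat) (A : 'I_n -> set 'rV[R]_3)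
    (eps z0 : R) a b X Y Ta Ba Tb :
  (forall i, strictly_convex (A i)) -> no_meeting_above A eps z0 -> 0 < z0 ->
  meeting A eps a b X Y -> depth X = z0 -> A b Tb -> depth Tb = 0 ->
  A a Ta -> depth Ta = 0 -> A a Ba -> z0 < depth Ba ->
  exists N, [/\ A a N, depth N = z0 & lat eps N != lat eps X].
Proof.
move=> sA minz z0_gt0 m zX bT zTb aT zTa aB zB.
pose t := z0 / depth Ba.
have tE : t * depth Ba = z0 by rewrite /t divfK//; lra.
have t_gt0 : 0 < t by rewrite divr_gt0//; lra.
have t_lt1 : t < 1 by nra.
have TB : Ta != Ba by apply/eqP => eTB; move: zB; rewrite -eTB zTa; lra.
have Nint := sA a Ta Ba t aT aB TB ltac:(lra).
set N := (1 - t) *: Ta + t *: Ba in Nint.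
have aN := interior_subset Nint.
have zN : depth N = z0 by rewrite depth_segment zTa mulr0 add0r.
exists N; split => //; apply/eqP => lN.
have uniq := first_meeting_unique sA minz z0_gt0 m zX bT zTb.
have NX := uniq _ aN zN lN.
have [s0 s0_gt0 Hs0] := interior_ray (point3 1 eps 0) Nint.
have : N + s0 *: point3 1 eps 0 = X.
  apply: uniq; first by apply: Hs0; lra.
    by rewrite depth_ray depth_point3 mulr0 addr0.
  by rewrite lat_ray lat_point3 lN; ring.
rewrite -NX => /eqP; rewrite -subr_eq0 addrAC subrr add0r scaler_eq0.
by rewrite (negPf (direction_neq0 _)) orbF => /eqP; lra.
Qed.

(** * Points at depth 0 and small generic parameters *)

Lemma top_unique (R : realType) (A : set 'rV[R]_3) X Y :
  strictly_convex A -> (forall v, A v -> 0 <= depth v) ->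
  A X -> A Y -> depth X = 0 -> depth Y = 0 -> X = Y.
Proof.
move=> sA posA aX aY zX zY; apply/eqP/negP => /negP neq.
have half : 0 < (1 / 2 : R) < 1 by lra.
have [s0 s0_gt0 Hs0] := interior_ray (point3 0 0 (-1)) (sA X Y _ aX aY neq half).
have := posA _ (Hs0 s0 ltac:(lra)).
by rewrite depth_ray depth_segment zX zY depth_point3; lra.
Qed.

(** For a body that touches depth 0 and also goes below it, every [z] smaller than one depth it
    reaches will do. Otherwise the claim is vacuous for small [z]: the body stays at depth 0, is
    empty, or by compactness has a positive least depth. *)
Lemma near_top_bracket (R : realType) (A : set 'rV[R]_3) :
  compact A -> (forall v, A v -> 0 <= depth v) ->
  \forall z \near 0^'+, forall X, A X -> 0 < depth X <= z ->
    exists T B, [/\ A T, depth T = 0, A B & z < depth B].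
Proof.
move=> cA posA.
have [[T [aT zT]]|noT] := pselect (exists T, A T /\ depth T = 0).
  have [[B [aB zB]]|noB] := pselect (exists B, A B /\ 0 < depth B).
    by near=> z => X _ _; exists T, B; split => //; near: z; exact: nbhs_right_lt.
  by near=> z => X aX /andP[zX _]; case: noB; exists X.
have [[X0 aX0]|A0] := pselect (A !=set0); last first.
  by near=> z => X aX; case: A0; exists X.
have [||M aM minM] := @compact_EVT_min _ R (@depth R) A _ cA.
- by exists X0.
- by apply: continuous_subspaceT; exact: depth_continuous.
move: aM; rewrite inE => aM.
have zM : 0 < depth M.
  by rewrite lt_neqAle posA// andbT eq_sym; apply/eqP => zM; case: noT; exists M.
near=> z => X aX /andP[_ Xz].
have : z < depth M by near: z; exact: nbhs_right_lt.
by have := minM X ltac:(by rewrite inE); lra.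
Unshelve. all: by end_near. Qed.

(** By [top_unique] a single pair of points matters. These are distinct by disjointness, so at most
    one positive [eps] gives them equal [lat]. *)
Lemma near_tops_apart (R : realType) (A B : set 'rV[R]_3) :
  strictly_convex A -> (forall v, A v -> 0 <= depth v) ->
  strictly_convex B -> (forall v, B v -> 0 <= depth v) ->
  (forall v, A v -> B v -> False) ->
  \forall eps \near 0^'+, forall X Y, A X -> B Y -> depth X = 0 ->
    depth Y = 0 -> lat eps X != lat eps Y.
Proof.
move=> sA pA sB pB dAB.
have [[X [aX zX]]|noX] := pselect (exists X, A X /\ depth X = 0); last first.
  by near=> e => X Y aX _ zX; case: noX; exists X.
have [[Y [bY zY]]|noY] := pselect (exists Y, B Y /\ depth Y = 0); last first.
  by near=> e => ? Y _ bY _ zY; case: noY; exists Y.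
suff : \forall eps \near 0^'+, lat eps X != lat eps Y.
  apply: filterS => e lXY X' Y' aX' bY' zX' zY'.
  by rewrite (top_unique sA pA aX' aX zX' zX) (top_unique sB pB bY' bY zY' zY).
have [yXY|yXY] := eqVneq (ordinate X) (ordinate Y).
  have xXY : abscissa X != abscissa Y.
    apply/eqP => xXY; apply: (dAB X) => //.
    by rewrite (@row3P _ X Y) // zX zY.
  near=> e.
  have e_gt0 : 0 < e by near: e; exact: nbhs_right_gt.
  apply: contraNneq xXY; rewrite /lat yXY => h.
  by apply/eqP/(mulfI (lt0r_neq0 e_gt0)); lra.
have [xXY|xXY] := eqVneq (abscissa X) (abscissa Y).
  near=> e; rewrite /lat xXY; apply/eqP => h; move/eqP: yXY; apply; lra.
(* [q] is the absolute slope of the line through the two tops; equal [lat] would force [e = q]. *)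
pose q := `|(ordinate X - ordinate Y) / (abscissa X - abscissa Y)|.
have q_gt0 : 0 < q by rewrite normr_gt0 mulf_neq0// ?invr_eq0 subr_eq0.
near=> e.
have e_gt0 : 0 < e by near: e; exact: nbhs_right_gt.
have : e < q by near: e; exact: nbhs_right_lt.
apply: contraTneq; rewrite /lat => h.
rewrite /q (_ : ordinate X - ordinate Y = e * (abscissa X - abscissa Y)); last lra.
by rewrite mulfK ?subr_eq0// gtr0_norm// ltxx.
Unshelve. all: by end_near. Qed.

(** * The ordinary line in dimension three *)

Lemma ordinary_line3 (R : realType) (n : nat) (A : 'I_n -> set 'rV[R]_3) a b :
  (forall i, compact (A i)) -> (forall i, strictly_convex (A i)) ->
  (forall i j v, A i v -> A j v -> i = j) ->
  (forall i v, A i v -> 0 <= depth v) -> a != b ->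
  A a (point3 0 0 0) -> A a (point3 0 0 1) ->
  A b (point3 1 0 0) -> A b (point3 0 1 1) ->
  exists X e r, [/\ e != 0, r != 0, (exists i, A i X),
    (exists i, A i (X + r *: e)) &
    forall i t, A i (X + t *: e) -> t = 0 \/ t = r].
Proof.
move=> cA sA dA posA ab a0 a1 b0 b1.
(* Finitely many conditions, each valid for all small positive [e], hold for a common [e]. [brk]
   controls the bodies near depth 0; [apart] excludes a meeting at depth 0. *)
have [e [e_gt0 brk apart]] : exists e : R, [/\ 0 < e,
    forall i X, A i X -> 0 < depth X <= e ->
      exists T B, [/\ A i T, depth T = 0, A i B & e < depth B] &
    forall i j, i != j -> forall X Y, A i X -> A j Y -> depth X = 0 ->
      depth Y = 0 -> lat e X != lat e Y].
  have near_e : \forall e \near (0 : R)^'+, [/\ 0 < e,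
    forall i X, A i X -> 0 < depth X <= e ->
      exists T B, [/\ A i T, depth T = 0, A i B & e < depth B] &
    forall i j, i != j -> forall X Y, A i X -> A j Y -> depth X = 0 ->
      depth Y = 0 -> lat e X != lat e Y].
    near=> e; split.
    - by near: e; exact: nbhs_right_gt.
    - near: e; apply: filter_forall => i.
      exact: near_top_bracket (cA i) (posA i).
    - near: e; apply: filter_forall => i; apply: filter_forall => j.
      have [->|ij] := eqVneq i j; first by near=> e; rewrite ?eqxx.
      apply: filterS (near_tops_apart (sA i) (posA i) (sA j) (posA j) _).
        by move=> e h _.
      by move=> v iv jv; move/eqP: ij; apply; exact: dA iv jv.
  by have [e He] := filter_ex near_e; exists e.
(* Equal [lat] on the segments joining the given points of [A a] and of [A b] means
   [z1 - e * (1 - z1) = 0]. Since [z1 < e], the first meeting falls in the range of [brk]. *)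
pose z1 := e / (1 + e).
have z1E : z1 * (1 + e) = e by rewrite /z1 divfK//; lra.
have z1_gt0 : 0 < z1 by rewrite divr_gt0//; lra.
have z1_lt1 : z1 < 1 by nra.
have z1_lte : z1 < e by nra.
have m1 : meeting A e a b
    ((1 - z1) *: point3 0 0 0 + z1 *: point3 0 0 1)
    ((1 - z1) *: point3 1 0 0 + z1 *: point3 0 1 1).
  split => //.
  - by apply: strictly_convex_segment => //; lra.
  - by apply: strictly_convex_segment => //; lra.
  - by rewrite !depth_segment !depth_point3.
  - by rewrite !lat_segment !lat_point3; lra.
have [c [d [X [Y [m minX]]]]] := first_meeting cA m1.
have [cd cX dY zXY lXY] := m.
have m' : meeting A e d c Y X by split; rewrite // eq_sym.
set z0 := depth X in minX.
have mn : no_meeting_above A e z0 by exact: minX.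
have z0_lte : z0 <= e.
  have := minX _ _ _ _ m1.
  by rewrite depth_segment !depth_point3; lra.
have z0_gt0 : 0 < z0.
  rewrite lt_neqAle (posA _ _ cX) andbT eq_sym; apply/eqP => zX.
  have := apart c d cd X Y cX dY zX; rewrite -zXY -/z0 zX => /(_ erefl).
  by rewrite lXY eqxx.
have tops i Z : A i Z -> depth Z = z0 ->
    exists T B, [/\ A i T, depth T = 0, A i B & z0 < depth B].
  move=> iZ zZ; have [|T [B [iT zT iB zB]]] := brk i Z iZ.
    by rewrite zZ z0_gt0 z0_lte.
  by exists T, B; split => //; lra.
(* Two bodies touching the line cannot both extend to the same side of it at
   depth [z0]: the one whose top lies on the other side would cross the other
   body's segment earlier. *)
have same_side i j Z W Ti Tj N N' : i != j -> A i Z -> A j W ->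
    depth Z = z0 -> depth W = z0 -> lat e Z = lat e X -> lat e W = lat e X ->
    A i Ti -> depth Ti = 0 -> A j Tj -> depth Tj = 0 ->
    A i N -> depth N = z0 -> A j N' -> depth N' = z0 ->
    (lat e N - lat e X) * (lat e N' - lat e X) <= 0.
  move=> ij iZ jW zZ zW lZ lW iT zTi jT zTj iN zN jN' zN'.
  have ji : j != i by rewrite eq_sym.
  have := apart _ _ ij _ _ iT jT zTi zTj; rewrite neq_lt => /orP[lT|lT].
  - have := no_crossing sA mn z0_gt0 ij iT iN jT jW zTi zTj zN zW lT.
    have := no_crossing sA mn z0_gt0 ij iT iZ jT jN' zTi zTj zZ zN' lT.
    by rewrite lZ lW => h1 h2; nra.
  - have := no_crossing sA mn z0_gt0 ji jT jN' iT iZ zTj zTi zN' zZ lT.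
    have := no_crossing sA mn z0_gt0 ji jT jW iT iN zTj zTi zW zN lT.
    by rewrite lZ lW => h1 h2; nra.
have [Tc [Bc [cT zTc cB zBc]]] := tops c X cX erefl.
have [Td [Bd [dT zTd dB zBd]]] := tops d Y dY (esym zXY).
have r_neq0 : abscissa Y - abscissa X != 0.
  rewrite subr_eq0; apply/eqP => xXY; move/eqP: cd; apply.
  apply: (dA _ _ X) => //; rewrite (@row3P _ X Y) //.
  by move: lXY; rewrite /lat xXY => /addIr.
have YE : X + (abscissa Y - abscissa X) *: point3 1 e 0 = Y.
  apply: row3P; rewrite /abscissa /ordinate /depth !mxE/=.
  - by ring.
  - by move: lXY; rewrite /lat /ordinate /abscissa => lXY; lra.
  - by rewrite mulr0 addr0; exact: zXY.
exists X, (point3 1 e 0), (abscissa Y - abscissa X).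
split; [exact: direction_neq0|exact: r_neq0|by exists c|by exists d; rewrite YE|].
move=> k t kZ; set Z := X + t *: point3 1 e 0 in kZ.
have zZ : depth Z = z0 by rewrite depth_ray depth_point3 mulr0 addr0.
have lZ : lat e Z = lat e X by rewrite lat_ray lat_point3; ring.
have xZ : abscissa Z = abscissa X + t by rewrite /abscissa !mxE/= mulr1.
have [kc|kc] := eqVneq k c.
  left; move: kZ; rewrite kc => cZ.
  have ZX := first_meeting_unique sA mn z0_gt0 m erefl dT zTd cZ zZ lZ.
  by move: xZ; rewrite ZX; lra.
have [kd|kd] := eqVneq k d.
  right; move: kZ; rewrite kd => dZ.
  have ZY := first_meeting_unique sA mn z0_gt0 m' (esym zXY) cT zTc dZ zZ
    (etrans lZ lXY).
  by move: xZ; rewrite ZY; lra.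
(* A third body [k] on the line gives, with [c] and [d], three nonzero lateral offsets; two of them
   have the same sign, against [same_side]. *)
exfalso.
have [Tk [Bk [kT zTk kB zBk]]] := tops k Z kZ zZ.
have mk : meeting A e k c Z X by split.
have [Nc [cN zNc lNc]] := off_line sA mn z0_gt0 m erefl dT zTd cT zTc cB zBc.
have [Nd [dN zNd lNd]] :=
  off_line sA mn z0_gt0 m' (esym zXY) cT zTc dT zTd dB zBd.
have [Nk [kN zNk lNk]] := off_line sA mn z0_gt0 mk zZ cT zTc kT zTk kB zBk.
have s1 := same_side _ _ _ _ _ _ _ _ cd cX dY erefl (esym zXY) erefl (esym lXY)
  cT zTc dT zTd cN zNc dN zNd.
have s2 := same_side _ _ _ _ _ _ _ _ kc kZ cX zZ erefl lZ erefl
  kT zTk cT zTc kN zNk cN zNc.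
have s3 := same_side _ _ _ _ _ _ _ _ kd kZ dY zZ (esym zXY) lZ (esym lXY)
  kT zTk dT zTd kN zNk dN zNd.
have {}lNc : lat e Nc - lat e X != 0 by rewrite subr_eq0.
have {}lNd : lat e Nd - lat e X != 0 by rewrite subr_eq0 lXY.
have {}lNk : lat e Nk - lat e X != 0 by rewrite subr_eq0 -lZ.
move: lNc lNd lNk s1 s2 s3; rewrite !neq_lt.
by case/orP => ?; case/orP => ?; case/orP => ?; nra.
Unshelve. all: by end_near. Qed.

(** * Linear forms and separation of a point *)

Definition lform (R : realType) (d : nat) (u : 'cV[R]_d) (x : 'rV[R]_d) : R :=
  (x *m u) 0 0.

Lemma lform_continuous (R : realType) (d : nat) (u : 'cV[R]_d) :
  continuous (lform u).
Proof.
move=> x; apply: (@continuous_comp _ _ _ (fun x : 'rV[R]_d => x *m u) (fun M : 'M[R]_1 => M 0 0)).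
  exact: mulmxr_continuous.
exact: coord_continuous.
Qed.

Lemma lformD (R : realType) (d : nat) (u : 'cV[R]_d) x y :
  lform u (x + y) = lform u x + lform u y.
Proof. by rewrite /lform mulmxDl mxE. Qed.

Lemma lformZ (R : realType) (d : nat) (u : 'cV[R]_d) a x :
  lform u (a *: x) = a * lform u x.
Proof. by rewrite /lform -scalemxAl mxE. Qed.

Lemma lformB (R : realType) (d : nat) (u : 'cV[R]_d) x y :
  lform u (x - y) = lform u x - lform u y.
Proof. by rewrite /lform mulmxBl !mxE. Qed.

Lemma lform_segment (R : realType) (d : nat) (u v : 'cV[R]_d) t x :
  lform ((1 - t) *: u + t *: v) x = lform u x + t * (lform v x - lform u x).
Proof. by rewrite /lform mulmxDr -!scalemxAr !mxE; ring. Qed.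

Lemma sqnorm_gt0 (R : realType) (d : nat) (x : 'rV[R]_d) :
  x != 0 -> 0 < lform x^T x.
Proof.
move=> x0; rewrite /lform mxE.
under eq_bigr do rewrite mxE -expr2.
rewrite lt_neqAle sumr_ge0 ?andbT; last by move=> i _; exact: sqr_ge0.
rewrite eq_sym psumr_eq0; last by move=> i _; exact: sqr_ge0.
apply: contra x0 => /allP h; apply/eqP/rowP => i; rewrite mxE.
by apply/eqP; rewrite -sqrf_eq0; apply: (h i); rewrite mem_index_enum.
Qed.

Lemma sqnorm_continuous (R : realType) (d : nat) (b : 'rV[R]_d) :
  continuous (fun x : 'rV[R]_d => lform (b - x)^T (b - x)).
Proof.
rewrite (_ : (fun x => _) =
  fun x : 'rV[R]_d => \sum_i (b 0 i - x 0 i) * (b 0 i - x 0 i)); last first.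
  apply/funext => x; rewrite /lform mxE.
  by apply: eq_bigr => i _; rewrite !mxE.
apply: continuous_big => [|i _ x]; first exact: add_continuous.
by apply: (@cvgM _ _ (nbhs x)); apply: (@cvgB _ _ _ (nbhs x));
  (exact: cvg_cst || exact: coord_continuous).
Qed.

(* The separating direction points from the nearest point of [A] to [b]. *)
Lemma separation (R : realType) (d : nat) (A : set 'rV[R]_d) b :
  compact A -> strictly_convex A -> A !=set0 -> ~ A b ->
  exists u, forall x, A x -> lform u x < lform u b.
Proof.
move=> cA sA A0 nAb.
have [|p pA minp] :=
    @compact_EVT_min _ R (fun x : 'rV[R]_d => lform (b - x)^T (b - x)) A A0 cA.
  by apply: continuous_subspaceT; exact: sqnorm_continuous.
move: pA; rewrite inE => pA.
have bp : b - p != 0.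
  by rewrite subr_eq0; apply/eqP => bp; apply: nAb; rewrite bp.
exists (b - p)^T => x Ax.
have : 0 < lform (b - p)^T b - lform (b - p)^T p.
  by rewrite -lformB; exact: sqnorm_gt0.
suff : lform (b - p)^T (x - p) <= 0 by rewrite lformB; lra.
rewrite leNgt; apply/negP; set g := lform _ _ => g0.
have xp : x - p != 0.
  by apply/eqP => xp; move: g0; rewrite /g xp /lform mul0mx mxE ltxx.
set N := lform (x - p)^T (x - p).
have N0 : 0 < N by exact: sqnorm_gt0.
(* Moving from [p] towards [x] by this [t] changes the squared distance to [b] by
   [- 2 * t * g + t * (t * N)], at most [- t * g], so [p] would not be nearest. *)
pose t := Num.min 1 (g / N).
have t0 : 0 < t by rewrite lt_min ltr01 divr_gt0.
have t1 : t <= 1 by rewrite ge_min lexx.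
have tN : t * N <= g by rewrite -ler_pdivlMr// ge_min lexx orbT.
have Aq : A ((1 - t) *: p + t *: x) by apply: strictly_convex_segment => //; lra.
have := minp _ (mem_set Aq).
have -> : b - ((1 - t) *: p + t *: x) = (b - p) - t *: (x - p).
  by apply/rowP => i; rewrite !mxE; ring.
have trp (v w : 'rV[R]_d) : lform v^T w = lform w^T v.
  by rewrite /lform !mxE; apply: eq_bigr => i _; rewrite !mxE mulrC.
have expand (y z : 'rV[R]_d) : lform (y - t *: z)^T (y - t *: z) =
    lform y^T y - 2 * t * lform y^T z + t * (t * lform z^T z).
  rewrite lformB lformZ [lform (y - _)^T y]trp [lform (y - _)^T z]trp.
  by rewrite !lformB !lformZ [lform z^T y]trp; ring.
rewrite expand -/g -/N.
nra.
Qed.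

(** * A hyperplane supporting two bodies *)

(** A maximum of affine functions of [t] whose slopes are bounded by the maximum of [|g|] on [A] is
    Lipschitz. For linear forms, [h] is the support function of [A] along a segment of
    directions. *)
Lemma max_affine_continuous (R : realType) (T : topologicalType)
    (A : set T) (f g : T -> R) :
  compact A -> A !=set0 -> continuous f -> continuous g ->
  exists2 h : R -> R, continuous h & forall t,
    (exists2 p, A p & h t = f p + t * g p) /\
    forall x, A x -> f x + t * g x <= h t.
Proof.
move=> cA A0 cf cg.
have attained t : exists p, A p /\ forall x, A x -> f x + t * g x <= f p + t * g p.
  have [|p pA maxp] := @compact_EVT_max _ R (fun x => f x + t * g x) A A0 cA.
    apply: continuous_subspaceT => x; apply: (@cvgD _ _ _ (nbhs x)); first exact: cf.
    by apply: (@cvgM _ _ (nbhs x)); [exact: cvg_cst|exact: cg].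
  by exists p; split; [rewrite inE in pA|move=> x Ax; apply: maxp; rewrite inE].
have [p Hp] := choice attained.
exists (fun t => f (p t) + t * g (p t)); last first.
  by move=> t; split; [exists (p t); [exact: (Hp t).1|]|exact: (Hp t).2].
have [|m mA maxm] := @compact_EVT_max _ R (fun x => `|g x|) A A0 cA.
  apply: continuous_subspaceT => x; apply: (@cvg_norm _ _ _ (nbhs x)); exact: cg.
have bnd x : A x -> `|g x| <= `|g m| by move=> Ax; apply: maxm; rewrite inE.
set C := `|g m| in bnd.
have C0 : 0 <= C by exact: normr_ge0.
have lip s t : f (p t) + t * g (p t) - (f (p s) + s * g (p s)) <= C * `|t - s|.
  have := (Hp s).2 _ (Hp t).1.
  have : (t - s) * g (p t) <= C * `|t - s|.
    apply: le_trans (ler_norm _) _; rewrite normrM mulrC ler_wpM2r//.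
    exact: bnd (Hp t).1.
  lra.
move=> t; apply/cvgrPdist_le => /= eps eps0.
near=> s.
have h : C * `|t - s| <= eps.
  apply: le_trans (_ : (C + 1) * `|t - s| <= eps); first by rewrite ler_wpM2r//; lra.
  rewrite mulrC -ler_pdivlMr; last by lra.
  near: s; apply/nbhs_ballP; exists (eps / (C + 1)) => /=.
    by rewrite divr_gt0//; lra.
  by move=> s; exact: ltW.
rewrite ler_norml; apply/andP; split; last by apply: le_trans (lip _ _) h.
by have := lip t s; rewrite distrC; lra.
Unshelve. all: by end_near. Qed.

(** The support function of [A] is at least that of [B] at [u] and at most that of [B] at [v]. By
    the intermediate value theorem they agree in between, and maximisers there give [p] and [q]. *)
Lemma segment_tie (R : realType) (d : nat) (A B : set 'rV[R]_d) u v a b :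
  compact A -> compact B -> A a -> B b ->
  (forall y, B y -> lform u y <= lform u a) ->
  (forall x, A x -> lform v x <= lform v b) ->
  exists2 t, 0 <= t <= 1 &
    let w := (1 - t) *: u + t *: v in
    exists p q, [/\ A p, B q, lform w q = lform w p &
      forall x, A x \/ B x -> lform w x <= lform w p].
Proof.
move=> cA cB Aa Bb maxu maxv.
have cg : continuous (fun x => lform v x - lform u x).
  by move=> x; apply: (@cvgB _ _ _ (nbhs x)); exact: lform_continuous.
have A0 : A !=set0 by exists a.
have B0 : B !=set0 by exists b.
have [h ch Hh] := max_affine_continuous cA A0 (@lform_continuous _ _ u) cg.
have [k ck Hk] := max_affine_continuous cB B0 (@lform_continuous _ _ u) cg.
have chk : {within `[0, 1], continuous (fun t => h t - k t)}.
  apply: continuous_subspaceT => t; apply: (@cvgB _ _ _ (nbhs t)).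
  - exact: ch.
  - exact: ck.
have h0 : k 0 <= h 0.
  have [[y By ->] _] := Hk 0; have := (Hh 0).2 _ Aa; have := maxu _ By; lra.
have h1 : h 1 <= k 1.
  have [[x Ax ->] _] := Hh 1; have := (Hk 1).2 _ Bb; have := maxv _ Ax; lra.
have [|t t01 hkt] := @IVT R (fun t => h t - k t) 0 1 0 ler01 chk.
  by rewrite ge_min le_max; apply/andP; split; apply/orP; [right|left]; lra.
exists t; first by move: t01; rewrite in_itv.
have [[p Ap hp] maxh] := Hh t; have [[q Bq kq] maxk] := Hk t.
exists p, q; split => //; rewrite ?lform_segment; first lra.
by move=> x [/maxh|/maxk]; rewrite !lform_segment; lra.
Qed.

(** The segment of directions used for turning must avoid 0, hence two independent directions [v1]
    and [v2]. A body extreme at [v1] is either not extreme at [v2], or extreme at both, and then one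
    of them can be turned to a direction [u] separating the body from a point of another. *)
Lemma common_support (R : realType) (d n : nat) (K : 'I_n -> set 'rV[R]_d) :
  (2 <= d)%N -> (2 <= n)%N -> trivIset [set: 'I_n] K ->
  (forall i, compact (K i)) -> (forall i, strictly_convex (K i)) ->
  (forall i, K i !=set0) ->
  exists w i j p q, [/\ w != 0, i != j, K i p, K j q & lform w q = lform w p /\
    forall k x, K k x -> lform w x <= lform w p].
Proof.
move=> hd hn dK cK sK K0.
have turn u v i k a b : (forall t, 0 <= t <= 1 -> (1 - t) *: u + t *: v != 0) ->
    K i a -> K k b -> k != i ->
    (forall j y, K j y -> lform u y <= lform u a) ->
    (forall x, K i x -> lform v x <= lform v b) ->
    exists w i j p q, [/\ w != 0, i != j, K i p, K j q & lform w q = lform w p /\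
      forall k x, K k x -> lform w x <= lform w p].
  move=> nz ia kb ki maxu maxv.
  (* Against all other bodies together, a tie is a maximum over the whole union. *)
  pose B := \bigcup_(j in [set` [pred j : 'I_n | j != i]]) K j.
  have cB : compact B by rewrite /B bigcup_pred; apply: bigsetU_compact.
  have Bb : B b by exists k.
  have [|t t01 [p [q [ip [j /= ji jq] eq_pq maxw]]]] :=
      @segment_tie _ _ (K i) B u v a b (cK i) cB ia Bb _ maxv.
    by move=> y [j _ jy]; exact: maxu jy.
  exists ((1 - t) *: u + t *: v), i, j, p, q; split => //.
  - exact: nz.
  - by rewrite eq_sym.
  - split => // l x lx; apply: maxw.
    by have [<-|li] := eqVneq l i; [left|right; exists l].
case: d hd K dK cK sK K0 turn => [//|[//|d]] _ K dK cK sK K0 turn.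
pose v1 : 'cV[R]_d.+2 := delta_mx 0 0.
pose v2 : 'cV[R]_d.+2 := delta_mx 1 0.
have v1v2 a b : a *: v1 = b *: v2 -> a = 0 /\ b = 0.
  move=> h; have := congr1 (fun M : 'cV_d.+2 => M 0 0) h.
  have := congr1 (fun M : 'cV_d.+2 => M 1 0) h.
  by rewrite /v1 /v2 !mxE /= !mulr1 !mulr0 => <- ->.
have [i [a [ia maxa]]] : exists i a, K i a /\
    forall j y, K j y -> lform v1 y <= lform v1 a.
  pose i0 := Ordinal (ltnW hn); have [x0 ix0] := K0 i0.
  have cU : compact (\bigcup_(j in [set` predT]) K j).
    by rewrite bigcup_pred; apply: bigsetU_compact.
  have [||a aU maxa] := @compact_EVT_max _ R (lform v1) _ _ cU.
  - by exists x0; exists i0.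
  - by apply: continuous_subspaceT; exact: lform_continuous.
  move: aU; rewrite inE => -[i _ ia]; exists i, a; split=> // j y jy.
  by apply: maxa; rewrite inE; exists j.
have [[a' [ia' maxa']]|nmax] := pselect (exists a', K i a' /\
    forall j y, K j y -> lform v2 y <= lform v2 a'); last first.
  have [|a' a'K maxa'] :=
      @compact_EVT_max _ R (lform v2) (K i) (K0 i) (cK i).
    by apply: continuous_subspaceT; exact: lform_continuous.
  move: a'K; rewrite inE => ia'.
  have [[k [b [kb ltb]]]|nb] :=
      pselect (exists k b, K k b /\ lform v2 a' < lform v2 b); last first.
    case: nmax; exists a'; split => // j y jy; rewrite leNgt; apply/negP => lt.
    by apply: nb; exists j, y.
  apply: (turn v1 v2 i k a b) => //.
  - move=> t _; apply/eqP => h.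
    have /v1v2[] : (1 - t) *: v1 = (- t) *: v2.
      by apply/eqP; rewrite scaleNr -addr_eq0 h.
    lra.
  - apply/eqP => ki; have := maxa' b; rewrite inE -ki => /(_ kb); lra.
  - move=> x ix; have := maxa' x; rewrite inE => /(_ ix); lra.
have [k ki] : exists k, k != i.
  have [->|] := eqVneq i (Ordinal (ltnW hn)); last by rewrite eq_sym; eexists; eassumption.
  by exists (Ordinal hn).
have [b kb] := K0 k.
have nib : ~ K i b.
  move=> ib; move/eqP: ki; apply.
  by apply: dK => //; exists b.
have [u sepu] := separation (cK i) (sK i) (K0 i) nib.
have u0 : u != 0.
  by apply/eqP => u0; have := sepu _ ia; rewrite u0 /lform !mulmx0 ltxx.
have zero v t : v != 0 -> (1 - t) *: v + t *: u = 0 -> exists c, u = c *: v.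
  move=> v0 h; have [t0|t0] := eqVneq t 0.
    by move: h; rewrite t0 subr0 scale1r scale0r addr0 => v0'; rewrite v0' eqxx in v0.
  exists (- (t^-1 * (1 - t))); apply: (scalerI t0).
  rewrite scalerA mulrN mulrA divff// mul1r scaleNr.
  by apply/eqP; rewrite -addr_eq0 addrC h.
(* If 0 lies between [v1] and [u], then [u] is a multiple of [v1]. Being nonzero, it is no multiple
   of [v2], so the turn from [v2] avoids 0. *)
have [[t [t01 zt]]|nz1] := pselect (exists t, 0 <= t <= 1 /\ (1 - t) *: v1 + t *: u = 0).
- have v10 : v1 != 0.
    by apply/eqP => e; have [] := v1v2 1 0; [rewrite e scaler0 scale0r|lra].
  have v20 : v2 != 0.
    by apply/eqP => e; have [] := v1v2 0 1; [rewrite e scaler0 scale0r|lra].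
  have [c uc] := zero _ _ v10 zt.
  apply: (turn v2 u i k a' b) => //; last by move=> x /sepu/ltW.
  move=> s _; apply/eqP => zs; have [c' uc'] := zero _ _ v20 zs.
  have [c0 _] := v1v2 c c' ltac:(by rewrite -uc -uc').
  by move/eqP: u0; apply; rewrite uc c0 scale0r.
- apply: (turn v1 u i k a b) => //; last by move=> x /sepu/ltW.
  by move=> t t01; apply/eqP => zt; apply: nz1; exists t.
Qed.

(** * Sections by affine flats *)

(** The preimage is the image, under a continuous left inverse [psi] of the embedding, of the part
    of [A] on the flat; the flat is closed, being cut out by the columns of [cokermx B]. *)
Lemma affine_preimage_compact (R : realType) (m d : nat) (B : 'M[R]_(m, d))
    (p : 'rV[R]_d) (A : set 'rV[R]_d) :
  row_free B -> compact A -> compact [set v | A (p + v *m B)].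
Proof.
move=> fB cA.
pose psi (x : 'rV[R]_d) := (x - p) *m pinvmx B.
have psi_cts : continuous psi.
  move=> x; apply: (@continuous_comp _ _ _ (fun x : 'rV[R]_d => x - p)
    (fun y : 'rV[R]_d => y *m pinvmx B)); last exact: mulmxr_continuous.
  by apply: (@cvgB _ _ _ (nbhs x)); [exact: cvg_id|exact: cvg_cst].
have -> : [set v | A (p + v *m B)] =
    psi @` (A `&` [set x | (x - p) *m cokermx B = 0]).
  apply/seteqP; split => [v /= Av|_ /= [x [Ax xB] <-]].
    exists (p + v *m B); last first.
      by rewrite /psi addrC addKr -mulmxA mulmxVp// mulmx1.
    by split => //; rewrite addrC addKr -mulmxA mulmx_coker mulmx0.
  have xpB : (x - p <= B)%MS by rewrite submxE xB.
  by rewrite /psi mulmxKpV// addrC subrK.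
apply: continuous_compact; first exact: continuous_subspaceT.
apply: compact_closedI => //.
rewrite (_ : [set x | _] =
  \bigcap_(j in [set: 'I_d]) [set x | lform (col j (cokermx B)) (x - p) = 0]).
  apply: closed_bigI => j _; apply: closed_eq_fun; last exact: cst_continuous.
  move=> x; under eq_fun do rewrite lformB.
  by apply: (@cvgB _ _ _ (nbhs x)); [exact: lform_continuous|exact: cvg_cst].
apply/seteqP; split => x /=.
  by move=> h j _ /=; rewrite /lform colE mulmxA h mul0mx mxE.
move=> h; apply/rowP => j; have /= := h j Logic.I.
by rewrite /lform colE mulmxA -colE mxE => ->; rewrite mxE.
Qed.

Lemma affine_preimage_strictly_convex (R : realType) (m d : nat)
    (B : 'M[R]_(m, d)) (p : 'rV[R]_d) (A : set 'rV[R]_d) :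
  row_free B -> strictly_convex A -> strictly_convex [set v | A (p + v *m B)].
Proof.
move=> fB sA x y t Ax Ay xy t01.
have neq : p + x *m B != p + y *m B.
  by apply: contra xy => /eqP/addrI/(row_free_inj fB) ->.
have cts : continuous (fun v : 'rV[R]_m => p + v *m B).
  move=> v; apply: (@cvgD _ _ _ (nbhs v)); first exact: cvg_cst.
  exact: mulmxr_continuous.
have := sA _ _ t Ax Ay neq t01.
have -> : (1 - t) *: (p + x *m B) + t *: (p + y *m B) =
    p + ((1 - t) *: x + t *: y) *m B.
  by rewrite mulmxDl -!scalemxAl !scalerDr addrACA -scalerDl subrK scale1r.
by move=> h; exact: (cts _ _ h).
Qed.

Lemma interior_below_max (R : realType) (d : nat) (A : set 'rV[R]_d) w x m :
  w != 0 -> interior A x -> (forall y, A y -> lform w y <= m) -> lform w x < m.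
Proof.
move=> w0 Ax maxw; have [s s0 Hs] := interior_ray w^T Ax.
have wT0 : w^T != 0 by apply: contra w0 => /eqP/(congr1 trmx); rewrite trmxK trmx0 => ->.
have := maxw _ (Hs s ltac:(lra)); rewrite lformD lformZ.
have := sqnorm_gt0 wT0; rewrite trmxK; nra.
Qed.

(** The kernel of [w] has dimension at least [d - 1], hence at least 2, and does not fit in the span
    of [e]. This is where [3 <= d] enters. *)
Lemma kernel_off_line (R : realType) (d : nat) (w : 'cV[R]_d) (e : 'rV[R]_d) :
  (3 <= d)%N -> exists2 g, lform w g = 0 & forall c, g != c *: e.
Proof.
move=> hd.
have /row_subPn[k hk] : ~~ (kermx w <= e)%MS.
  apply/negP => /mxrankS; rewrite mxrank_ker.
  have := rank_leq_col w; have := rank_leq_row e; lia.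
exists (row k (kermx w)).
  by rewrite /lform -row_mul mulmx_ker !mxE.
by move=> c; apply: contra hk => /eqP ->; exact: scalemx_sub.
Qed.

Lemma point_at_level (R : realType) (d : nat) (A : set 'rV[R]_d) w p b l :
  strictly_convex A -> A p -> A b -> lform w b < l -> l < lform w p ->
  exists2 a, interior A a & lform w a = l.
Proof.
move=> sA Ap Ab bl lp.
have D0 : 0 < lform w p - lform w b by lra.
pose s := (lform w p - l) / (lform w p - lform w b).
have sE : s * (lform w p - lform w b) = lform w p - l.
  by rewrite /s divfK//; exact: lt0r_neq0.
have s0 : 0 < s by rewrite divr_gt0//; lra.
have s1 : s < 1 by nra.
exists ((1 - s) *: p + s *: b); last by rewrite lformD !lformZ; lra.
apply: sA => //; last lra.
by apply/eqP => pb; move: bl lp; rewrite pb; lra.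
Qed.

(** * Choice of the three-dimensional flat *)

Theorem theorem5 (R : realType) (d n : nat) (hd : (3 <= d)%N) (hn : (2 <= n)%N)
    (K : 'I_n -> set 'rV[R]_d) (hK : convex_system K) :
  exists L : set 'rV[R]_d, ordinary_line K L.
Proof.
have [d2 _ dK HK] := hK.
have cK i : compact (K i) by have [] := HK i.
have sK i : strictly_convex (K i) by have [] := HK i.
have oK i : interior (K i) !=set0 by have [] := HK i.
have K0 i : K i !=set0 by have [x /interior_subset ?] := oK i; exists x.
have [w [i [j [p [q [w0 ij ip jq [wq maxw]]]]]]] :=
  common_support d2 hn dK cK sK K0.
have [bi bi_int] := oK i; have [bj bj_int] := oK j.
have wbi := interior_below_max w0 bi_int (maxw i).
have wbj := interior_below_max w0 bj_int (maxw j).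
(* A level strictly between the values at both interior points and the maximum contains interior
   points of both bodies. *)
pose l := (Num.max (lform w bi) (lform w bj) + lform w p) / 2.
have mi : lform w bi <= Num.max (lform w bi) (lform w bj) by rewrite le_max lexx.
have mj : lform w bj <= Num.max (lform w bi) (lform w bj).
  by rewrite le_max lexx orbT.
have mp : Num.max (lform w bi) (lform w bj) < lform w p by rewrite gt_max wbi wbj.
have lp : l < lform w p by rewrite /l; lra.
have [ai ai_int wai] : exists2 a, interior (K i) a & lform w a = l.
  apply: (point_at_level (sK i) ip (interior_subset bi_int)) => //.
  by rewrite /l; lra.
have [aj' aj'_int waj'] : exists2 a, interior (K j) a & lform w a = l.
  apply: (point_at_level (sK j) jq (interior_subset bj_int)); rewrite ?wq//.
  by rewrite /l; lra.
pose e := q - p.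
have e0 : e != 0.
  rewrite subr_eq0; apply/eqP => qp; move/eqP: ij; apply.
  by apply: dK => //; exists p; split => //; rewrite -qp.
have we : lform w e = 0 by rewrite lformB wq subrr.
(* If [aj' - ai] is parallel to [e], a small move of [aj'] within its level and its body, along some
   [g] not parallel to [e], removes the dependence. *)
have [aj [jaj waj apar]] : exists aj, [/\ K j aj, lform w aj = l &
    forall c, aj - ai != c *: e].
  have [[c hc]|nc] := pselect (exists c, aj' - ai = c *: e); last first.
    exists aj'; split=> //; first exact: interior_subset.
    by move=> c; apply/eqP => hc; apply: nc; exists c.
  have [g wg ge] := kernel_off_line w e hd.
  have [s s0 Hs] := interior_ray g aj'_int.
  exists (aj' + s *: g); split; first by apply: Hs; lra.
    by rewrite lformD lformZ wg waj' mulr0 addr0.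
  move=> c'; apply: contra (ge (s^-1 * (c' - c))) => /eqP hc'.
  have sg : (c' - c) *: e = s *: g.
    by rewrite scalerBl -hc -hc'; apply/rowP => k; rewrite !mxE; ring.
  by rewrite -scalerA sg scalerA mulVf ?scale1r//; lra.
pose f := aj - ai.
have wf : lform w f = 0 by rewrite lformB waj wai subrr.
(* With origin [p] and these rows as basis, [q], [ai] and [aj] become (1, 0, 0), (0, 0, 1) and (0,
   1, 1), as [ordinary_line3] requires. *)
pose B : 'M[R]_(3, d) := \matrix_(k < 3) [:: e; f; ai - p]`_k.
have BE (v : 'rV[R]_3) :
    v *m B = abscissa v *: e + ordinate v *: f + depth v *: (ai - p).
  rewrite mulmx_sum_row !big_ord_recl big_ord0 addr0 !rowK /= addrA.
  by congr (_ *: _ + _ *: _ + _ *: _); congr (v _ _); apply: val_inj.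
have wB v : lform w (p + v *m B) = lform w p + depth v * (l - lform w p).
  by rewrite lformD BE 2!lformD !lformZ we wf lformB wai; ring.
(* In a vanishing combination, [w] kills the depth coefficient, [apar] that of [f], and [e0] that of
   [e]. *)
have fB : row_free B.
  apply: inj_row_free => v vB.
  have z0 : depth v = 0.
    have := wB v; rewrite vB addr0 => /eqP.
    rewrite -subr_eq0 opprD addNKr oppr_eq0 mulf_eq0 => /orP[/eqP//|/eqP]; lra.
  move: vB; rewrite BE z0 scale0r addr0 => /eqP; rewrite addr_eq0 => /eqP vB.
  have y0 : ordinate v = 0.
    apply/eqP/negP => /negP y0.
    have /negP[] := apar (- ((ordinate v)^-1 * abscissa v)).
    apply/eqP/(scalerI y0); rewrite -/f scalerA mulrN mulrA divff// mul1r.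
    by rewrite scaleNr vB opprK.
  move: vB; rewrite y0 scale0r oppr0 => /eqP; rewrite scaler_eq0 (negPf e0) orbF.
  by move=> /eqP x0; apply: row3P; rewrite ?x0 ?y0 ?z0 /abscissa /ordinate /depth mxE.
have [X [u [r [u0 r0 [k kX] [k' kY] only]]]] : exists X u r,
    [/\ u != 0, r != 0, (exists k, K k (p + X *m B)),
      (exists k, K k (p + (X + r *: u) *m B)) &
      forall k t, K k (p + (X + t *: u) *m B) -> t = 0 \/ t = r].
  apply: (@ordinary_line3 R n (fun k => [set v | K k (p + v *m B)]) i j) => //.
  - by move=> k; apply: affine_preimage_compact.
  - by move=> k; apply: affine_preimage_strictly_convex.
  - by move=> k k' v kv k'v; apply: dK => //; exists (p + v *m B).
  - by move=> k v /= /maxw; rewrite wB; nra.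
  - rewrite /= BE /abscissa /ordinate /depth !mxE/=.
    by rewrite !scale0r !addr0.
  - rewrite /= BE /abscissa /ordinate /depth !mxE/=.
    rewrite !scale0r scale1r !add0r addrC subrK; exact: interior_subset.
  - rewrite /= BE /abscissa /ordinate /depth !mxE/=.
    by rewrite !scale0r scale1r !addr0 addrC subrK.
  - rewrite /= BE /abscissa /ordinate /depth !mxE/=.
    by rewrite !scale0r !scale1r add0r addrC addrA !subrK.
have lineE t : p + (X + t *: u) *m B = p + X *m B + t *: (u *m B).
  by rewrite mulmxDl -scalemxAl addrA.
have uB0 : u *m B != 0.
  by apply: contra u0 => /eqP uB; apply/eqP/(row_free_inj fB); rewrite uB mul0mx.
exists [set p + X *m B + t *: (u *m B) | t in [set: R]]; split.
  by exists (p + X *m B), (u *m B).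
exists (p + X *m B), (p + X *m B + r *: (u *m B)); split.
  by rewrite eq_sym -subr_eq0 addrC addKr scaler_eq0 negb_or r0.
apply/seteqP; split => [x [[t _ <-] [k'' _]]|x [->|->]].
- by rewrite -lineE => /only[->|->]; [left|right]; rewrite lineE// scale0r addr0.
- by split; [exists 0 => //; rewrite scale0r addr0|exists k].
- by split; [exists r|exists k' => //; rewrite -lineE].
Qed.
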